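(* Let $M,\widetilde M\in\mathbb{C}^{n\times n}$ be normal matrices with eigenvalues $\lambda_j$, $\widetilde\lambda_j$ and corresponding orthonormal eigenvectors $\mathbf{u}_j$, $\widetilde{\mathbf{u}}_j$ ($j\in N=\{1,\dots,n\}$). Let $J\subseteq N$ with $|J|=q$, $1\le q\le n-1$, and $J^c=N\setminus J$. Suppose $\|\widetilde M-M\|_2<\frac12\,\mathrm{sep}(\lambda_J,\lambda_{J^c})$, and let $$\widehat J=\left\{j'\in N\ \middle|\ \min_{j\in N}|\widetilde\lambda_{j'}-\lambda_j|=\min_{j\in J}|\widetilde\lambda_{j'}-\lambda_j|\right\}.$$ Then: 1. $$d_{\mathrm{sp}}\left(\mathrm{span}(\mathbf{u}_J),\mathrm{span}(\widetilde{\mathbf{u}}_{\widehat J})\right)\le\frac1{\sqrt q}\min\left(\sqrt{\sum_{j\in J}\left(\frac{\|(\widetilde M-M)\mathbf{u}_j\|_2}{\min_{k\in J^c}|\lambda_k-\lambda_j|-\|\widetilde M-M\|_2}\right)^2},\ \sqrt{\sum_{j\in J^c}\left(\frac{\|(\widetilde M-M)\mathbf{u}_j\|_2}{\min_{k\in J}|\lambda_k-\lambda_j|-\|\widetilde M-M\|_2}\right)^2}\right)$$ and the right-hand side is at most $$\min\left(1,\sqrt{\frac{n-q}{q}}\right)\frac{\|\widetilde M-M\|_2}{\mathrm{sep}(\lambda_J,\lambda_{J^c})-\|\widetilde M-M\|_2}.$$ 2. $$d_{\mathrm{sp}}\left(\mathrm{span}(\mathbf{u}_J),\mathrm{span}(\widetilde{\mathbf{u}}_{\widehat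 J})\right)\le\frac{\frac1{\sqrt{2q}}\|\widetilde M-M\|_F}{\mathrm{sep}(\lambda_J,\lambda_{J^c})-\|\widetilde M-M\|_2}.$$
   Context: For $S\subseteq N=\{1,\dots,n\}$: $\mathbf{u}_S=\{\mathbf{u}_j\mid j\in S\}$, $\widetilde{\mathbf{u}}_S=\{\widetilde{\mathbf{u}}_{j}\mid j\in S\}$, $\lambda_S=\{\lambda_j\mid j\in S\}$ (multiset). Spans are complex linear spans in $\mathbb{C}^n$. Eigenvalues are listed with multiplicity, and $\{\mathbf{u}_j\}_{j\in N}$, $\{\widetilde{\mathbf{u}}_j\}_{j\in N}$ are orthonormal bases of $\mathbb{C}^n$ with $M\mathbf{u}_j=\lambda_j\mathbf{u}_j$, $\widetilde M\widetilde{\mathbf{u}}_j=\widetilde\lambda_j\widetilde{\mathbf{u}}_j$. $\|\cdot\|_2$ is the Euclidean norm on vectors and the induced operator norm on matrices; $\|\cdot\|_F$ is the Frobenius norm. $\mathrm{sep}(P,Q)=\min_{p\in P,\,q\in Q}|p-q|$. Subspace distance: for $q$-dimensional subspaces $X,Y\subseteq\mathbb{C}^n$, let $\mathbf{X},\mathbf{Y}\in\mathbb{C}^{n\times q}$ be matrices whose columns are orthonormal bases of $X$ and $Y$; then $d_{\mathrm{sp}}(X,Y)=\frac{1}{\sqrt{2q}}\|\mathbf{X}\mathbf{X}^\dagger-\mathbf{Y}\mathbf{Y}^\dagger\|_F$, where $^\dagger$ is the conjugate transpose (this does not depend on the chosen bases). Under the stated hypothesis it is known that $|\widehat J|=|J|=q$,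 so that $\mathrm{span}(\widetilde{\mathbf{u}}_{\widehat J})$ is $q$-dimensional and the distance is defined. *)

(* Defs.v *)
From mathcomp Require Import all_boot all_order all_algebra.
From mathcomp Require Import complex.
From mathcomp Require Import boolp classical_sets reals.

Set Implicit Arguments.
Unset Strict Implicit.
Unset Printing Implicit Defensive.

Import Order.TTheory GRing.Theory Num.Theory.

Local Open Scope ring_scope.
Local Open Scope sesquilinear_scope.

(* Modulus of a complex number as an element of R (the norm `|z| of R[i] is
   valued in R[i]). *)
Notation cabs := (@ComplexField.Normc.normc _).

(* Minimum of a finite list; the value 0 on the empty list is a junk value. *)
Definition minseq (R : realType) (s : seq R) : R :=
  if s is x :: s' then \big[Num.min/x]_(y <- s') y else 0.

(* Finite multisets of complex numbers are represented by sequences. *)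
Definition sep (R : realType) (P Q : seq R[i]) : R :=
  minseq [seq cabs (p - q) | p <- P, q <- Q].

Definition frobnorm (R : realType) (m n : nat) (A : 'M[R[i]]_(m, n)) : R :=
  Num.sqrt (\sum_(i < m) \sum_(j < n) cabs (A i j) ^+ 2).

Definition enorm (R : realType) (n : nat) (v : 'cV[R[i]]_n) : R :=
  Num.sqrt (\sum_(i < n) cabs (v i 0) ^+ 2).

Definition opnorm (R : realType) (m n : nat) (A : 'M[R[i]]_(m, n)) : R :=
  sup [set enorm (A *m v) | v in [set v : 'cV[R[i]]_n | enorm v <= 1]]%classic.

Definition orthonormal_basis (R : realType) (n m : nat)
    (V : {vspace 'cV[R[i]]_n}) (b : 'I_m -> 'cV[R[i]]_n) : Prop :=
  basis_of V [seq b j | j : 'I_m] /\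
  (forall i j : 'I_m, (b i)^t* *m b j = (i == j)%:R%:M).

(* X X^dagger, where the columns of X are a chosen orthonormal basis of V;
   such an X always exists, so the default value 0 of xget is never reached. *)
Definition onb_mx (R : realType) (n : nat) (V : {vspace 'cV[R[i]]_n}) :
    'M[R[i]]_(n, \dim V) :=
  xget 0 [set X : 'M[R[i]]_(n, \dim V) |
          orthonormal_basis V (fun j => col j X)]%classic.

Definition projector (R : realType) (n : nat) (V : {vspace 'cV[R[i]]_n}) :
    'M[R[i]]_n :=
  onb_mx V *m (onb_mx V)^t*.

(* Only meaningful when \dim V = \dim W = q > 0. *)
Definition dsp (R : realType) (n : nat) (V W : {vspace 'cV[R[i]]_n}) : R :=
  (Num.sqrt (2 * \dim V)%:R)^-1 * frobnorm (projector V - projector W).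

Definition span_of (R : realType) (n : nat) (u : 'I_n -> 'cV[R[i]]_n)
    (S : {set 'I_n}) : {vspace 'cV[R[i]]_n} :=
  <<[seq u j | j in S]>>%VS.

Definition hat_set (R : realType) (n : nat) (lam lamt : 'I_n -> R[i])
    (J : {set 'I_n}) : {set 'I_n} :=
  [set j' | minseq [seq cabs (lamt j' - lam j) | j : 'I_n]
            == minseq [seq cabs (lamt j' - lam j) | j in J]].

(* Main.v *)
Require Import Defs.
From mathcomp Require Import all_boot all_order all_algebra.
From mathcomp Require Import complex.
From mathcomp Require Import ring lra.
From mathcomp Require Import boolp classical_sets reals.
Import Order.TTheory GRing.Theory Num.Theory.
Local Open Scope ring_scope.

(** With [W = Ut^* U] and [E = Mt - M], the entries of [Ut^* E U] are
    [(lamt k - lam j) W k j], while the squared Frobenius distance of the two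
    projectors is the sum of [|W k j|^2] over the pairs [(j, k)] with exactly one
    of [j \in J], [k \in hat J].  As [W] is unitary and [#|hat J| = #|J|], the
    blocks [J x (hat J)^c] and [J^c x hat J] contribute equally, and on both of
    them [|lamt k - lam j|] is bounded below by the gap minus [||E||_2].
    The equality [#|hat J| = #|J|] is topological: along [M + x E], [0 <= x <= 1],
    Bauer-Fike keeps the spectrum within [||E||_2] of that of [M], so by
    continuity of the roots of the characteristic polynomial no eigenvalue moves
    from the cluster of [J] to that of [J^c]. *)

Set Implicit Arguments.
Unset Strict Implicit.
Local Open Scope sesquilinear_scope.
Local Open Scope complex_scope.

(** * Continuity of the roots of monic polynomials *)

Section PolyRoots.
Variable C : numFieldType.
Implicit Types (s t : seq C) (p q : {poly C}).

Definition prod_roots s : {poly C} := \prod_(z <- s) ('X - z%:P).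

Lemma size_prod_roots s : size (prod_roots s) = (size s).+1.
Proof. exact: size_prod_XsubC. Qed.

(** Multiplying by ['X - a%:P] subtracts [a] times the coefficients from a shifted copy of them, so
    each root costs a factor [1 + B]. *)
Lemma prod_roots_coef_le B s i : 0 <= B -> {in s, forall z, `|z| <= B} ->
  `|(prod_roots s)`_i| <= (1 + B) ^+ size s.
Proof.
move=> B0; elim: s i => [|a s IHs] i sB.
  by rewrite /prod_roots big_nil coef1 expr0 normr_nat lern1 leq_b1.
have aB : `|a| <= B by apply: sB; rewrite mem_head.
have {}IHs j : `|(prod_roots s)`_j| <= (1 + B) ^+ size s.
  by apply: IHs => z zs; apply: sB; rewrite inE zs orbT.
rewrite /prod_roots big_cons -/(prod_roots s) mulrBl coefB coefXM coefCM.
apply: le_trans (ler_normB _ _) _; rewrite /= exprS mulrDl mul1r normrM.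
apply: lerD; last by rewrite ler_pM.
by case: eqP => // _; rewrite normr0 exprn_ge0 // addr_ge0.
Qed.

(** Were every root in [t] farther than [e] from [a], the product of the distances, which is the
    modulus of [prod_roots t] at [a], would exceed [e ^+ size t]. *)
Lemma exists_close_root e p t (a : C) :
  0 <= e -> root p a -> `|p.[a] - (prod_roots t).[a]| <= e ^+ size t ->
  (0 < size t)%N -> exists2 b, b \in t & `|a - b| <= e.
Proof.
move=> e0 /rootP ->; rewrite sub0r normrN horner_prod normr_prod => le_e t0.
apply/hasP; apply/negPn/negP => /hasPn far.
move: le_e; apply/negP; rewrite -real_ltNge ?realE ?exprn_ge0 ?prodr_ge0 //.
elim: t t0 far => // b t IHt _ far; rewrite big_cons /= exprS.
have eb : e < `|('X - b%:P).[a]|.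
  by rewrite !hornerE real_ltNge ?realE ?e0 ?normr_ge0 // far ?mem_head.
case: (posnP (size t)) => [/size0nil -> | t0].
  by rewrite big_nil expr0 !mulr1.
rewrite ltr_pM ?exprn_ge0 //; apply: IHt => // z zt.
by apply: far; rewrite inE zt orbT.
Qed.

(* Division by [X - a] is synthetic division from the top coefficient down. *)
Lemma coef_quotient_le B r p (a : C) n : 0 <= B -> `|a| <= B ->
  (forall i, `|(('X - a%:P) * p)`_i| <= r) -> (size p <= n)%N ->
  forall i, `|p`_i| <= r * (1 + B) ^+ n.
Proof.
move=> B0 aB le_r le_n i.
have r0 : 0 <= r by apply: le_trans (le_r 0%N).
have B1 : 1 <= 1 + B by rewrite lerDl.
have: (n <= i + n)%N by rewrite leq_addl.
(* Here [k] measures the descent from the top: the claim becomes the bound [r * (1 + B) ^+ k] for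
   every [i] with [n <= i + k]. *)
move: {2 3}n => k; elim: k i => [|k IHk] i.
  rewrite addn0 => le_ni; rewrite nth_default ?(leq_trans le_n) //.
  by rewrite normr0 mulr_ge0.
rewrite -addSnnS => /IHk le_k.
have -> : p`_i = (('X - a%:P) * p)`_i.+1 + a * p`_i.+1.
  by rewrite mulrBl coefB coefXM coefCM /= subrK.
apply: le_trans (ler_normD _ _) _; rewrite exprS [leRHS]mulrCA [leRHS]mulrDl mul1r.
apply: lerD; first by rewrite (le_trans (le_r _)) // ler_peMr // exprn_ege1.
by rewrite normrM ler_pM.
Qed.

(* Roots are matched one at a time: a root [a] of the first polynomial is close
   to a root [b] of the second, and dividing by [X - a] and [X - b] keeps the
   coefficients close. *)
Lemma count_roots_stable n (B e : C) : 0 <= B -> 0 < e ->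
  exists2 eta : C, 0 < eta & forall s t (D : pred C),
    size s = n -> size t = n ->
    {in s, forall z, `|z| <= B} -> {in t, forall z, `|z| <= B} ->
    (forall i, `|(prod_roots s)`_i - (prod_roots t)`_i| <= eta) ->
    {in s & t, forall a b, `|a - b| <= e -> D a = D b} ->
    count D s = count D t.
Proof.
move=> B0 e0; elim: n => [|n [eta eta0 IHn]].
  by exists 1 => // s t D /size0nil -> /size0nil ->.
have B1 : 0 < 1 + B by rewrite ltr_pwDl.
(* The order of [C] is only partial; [x * y / (x + y)] serves as an explicit common lower bound. *)
have min_exists (x y : C) : 0 < x -> 0 < y ->
    exists z, [/\ 0 < z, z <= x & z <= y].
  move=> x0 y0; have xy0 : 0 < x + y by rewrite addr_gt0.
  exists (x * y / (x + y)); rewrite !ler_pdivrMr // mulrDr mulrDr.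
  rewrite divr_gt0 ?mulr_gt0 //; split=> //; first by rewrite lerDr mulr_ge0 ?ltW.
  by rewrite [y * x]mulrC lerDl mulr_ge0 ?ltW.
pose c := (1 + B) ^+ n.+1.
have c0 : 0 < c by rewrite exprn_gt0.
(* Dividing by ['X - a%:P] will cost a factor [c], so the error before division must stay below
   [eta / c]. Half of it pays for replacing [b] by [a], which costs [e1] times a coefficient bounded
   by [c]; the bound [e1 <= e] makes [D] agree on [a] and [b]. *)
have [e1 [e1_gt0 e1_le_e e1_le]] : exists z : C,
    [/\ 0 < z, z <= e & z <= eta / c / 2 / c].
  by apply: min_exists; rewrite ?divr_gt0 ?ltr0n.
(* The two polynomials have degree [n.+1], hence [n.+2] coefficients: if these differ by at most
   [eta1], the values at [a] differ by at most [eta1 * S]. The other half of [eta / c] goes to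
   [eta1] itself. *)
pose S := \sum_(i < n.+2) B ^+ i.
have S0 : 0 < S by rewrite /S big_ord_recl expr0 ltr_pwDl // sumr_ge0 // => i _; rewrite exprn_ge0.
have [eta1 [eta1_gt0 eta1_le eta1_le']] : exists z : C,
    [/\ 0 < z, z <= eta / c / 2 & z <= e1 ^+ n.+1 / S].
  by apply: min_exists; rewrite ?divr_gt0 ?ltr0n ?exprn_gt0.
exists eta1 => // -[|a s] // t D [sz_s] sz_t sB tB close Dst.
have aB : `|a| <= B by rewrite sB ?mem_head.
have [b bt ab] : exists2 b, b \in t & `|a - b| <= e1.
  apply: (@exists_close_root e1 (prod_roots (a :: s))); rewrite ?sz_t //; first exact: ltW.
    by rewrite root_prod_XsubC mem_head.
  rewrite -hornerN -hornerD (@horner_coef_wide _ n.+2); last first.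
    apply: leq_trans (size_polyD _ _) _; rewrite size_polyN !size_prod_roots.
    by rewrite sz_t /= sz_s maxnn.
  apply: le_trans (ler_norm_sum _ _ _) _.
  apply: (@le_trans _ _ (eta1 * S)); last by rewrite -ler_pdivlMr.
  rewrite mulr_sumr; apply: ler_sum => i _.
  by rewrite normrM normrX coefB ler_pM ?exprn_ge0 ?lerXn2r ?nnegrE.
have [t' t_perm] : exists t', perm_eq t (b :: t') by exists (rem b t); exact: perm_to_rem.
have sz_t' : size t' = n by move: (perm_size t_perm); rewrite sz_t => -[].
have Dab : D a = D b by apply: Dst (le_trans ab e1_le_e); rewrite ?mem_head.
have t't z : z \in t' -> z \in t by rewrite (perm_mem t_perm) inE => ->; rewrite orbT.
have ss z : z \in s -> z \in a :: s by rewrite inE => ->; rewrite orbT.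
rewrite (permP t_perm) /= Dab; congr (_ + _)%N.
apply: IHn => // [z /ss/sB //|z /t't/tB //||x y /ss xs /t't]; last exact: Dst.
move=> i; rewrite -coefB.
apply: le_trans (_ : (eta / c) * (1 + B) ^+ n.+1 <= _); last by rewrite divfK ?gt_eqF.
apply: (@coef_quotient_le B _ _ a) => //; last first.
  apply: leq_trans (size_polyD _ _) _; rewrite size_polyN !size_prod_roots.
  by rewrite sz_s sz_t' maxnn.
move=> j.
(* Writing [prod_roots t] as [('X - b%:P) * prod_roots t'] isolates the error caused by dividing by
   two different linear factors. *)
have -> : ('X - a%:P) * (prod_roots s - prod_roots t') =
    (prod_roots (a :: s) - prod_roots t) + (a - b) *: prod_roots t'.
  rewrite [prod_roots t](perm_big _ t_perm) /prod_roots !big_cons /= -mul_polyC.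
  have -> : (a - b)%:P = ('X - b%:P) - ('X - a%:P).
    by rewrite polyCB opprB [RHS]addrC addrA subrK.
  by rewrite mulrBr [(_ - _ - _) * _]mulrBl addrA subrK.
rewrite coefD coefZ coefB; apply: le_trans (ler_normD _ _) _.
rewrite [leRHS]splitr; apply: lerD; first exact: le_trans (close _) _.
rewrite ler_pdivlMr // in e1_le; rewrite normrM (le_trans _ e1_le) //.
rewrite ler_pM // (le_trans (_ : _ <= (1 + B) ^+ n)) //.
  by rewrite -sz_t'; apply: prod_roots_coef_le => // z /t't; exact: tB.
by rewrite /c exprS ler_peMl ?lerDl // ltW ?exprn_gt0.
Qed.

Lemma poly_lipschitz p : exists2 L : C, 0 <= L &
  forall x y, `|x| <= 1 -> `|y| <= 1 -> `|p.[x] - p.[y]| <= L * `|x - y|.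
Proof.
(* The induction also carries a bound of [p] on the unit disc, needed for the term [p.[y] * (x - y)]
   of the product rule. *)
suff [L [L0 _ lip]] : exists L : C, [/\ 0 <= L, forall x, `|x| <= 1 -> `|p.[x]| <= L &
    forall x y, `|x| <= 1 -> `|y| <= 1 -> `|p.[x] - p.[y]| <= L * `|x - y|].
  by exists L.
elim/poly_ind: p => [|p c [L [L0 bd lip]]].
  by exists 0; split=> // x *; rewrite !horner0 ?subrr normr0 ?mul0r.
exists (L + L + `|c|); split=> [||x y x1 y1]; first by rewrite !addr_ge0.
  move=> x x1; rewrite !hornerE (le_trans (ler_normD _ _)) // lerD // normrM.
  by rewrite (le_trans (_ : _ <= L * 1)) ?ler_pM ?bd // mulr1 lerDl.
rewrite !hornerE opprD addrACA subrr addr0.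
have -> : p.[x] * x - p.[y] * y = (p.[x] - p.[y]) * x + p.[y] * (x - y).
  by rewrite mulrBl mulrBr addrA subrK.
apply: le_trans (ler_normD _ _) _; rewrite !normrM !mulrDl.
rewrite (le_trans (_ : _ <= L * `|x - y| + L * `|x - y|)) //; last first.
  by rewrite lerDl mulr_ge0.
apply: lerD; last by rewrite ler_wpM2r ?bd.
by rewrite -[leRHS]mulr1 ler_pM ?lip.
Qed.

(** The coefficients are polynomials in the parameter: they are those of the characteristic
    polynomial of [M + 'X *: E], taken over [{poly C}] and evaluated at [x]. *)
Lemma char_poly_pencil_lipschitz n (M E : 'M[C]_n) :
  exists2 L : C, 0 <= L & forall i x y, `|x| <= 1 -> `|y| <= 1 ->
    `|(char_poly (M + x *: E))`_i - (char_poly (M + y *: E))`_i| <= L * `|x - y|.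
Proof.
pose G : 'M[{poly C}]_n := map_mx polyC M + 'X *: map_mx polyC E.
have G_eval i x : (char_poly (M + x *: E))`_i = ((char_poly G)`_i).[x].
  have -> : M + x *: E = map_mx (horner_eval x) G.
    by apply/matrixP=> k j; rewrite !mxE /horner_eval !hornerE.
  by rewrite -map_char_poly coef_map.
have /fin_all_exists2 [L L0 lip] (i : 'I_n.+1) := poly_lipschitz (char_poly G)`_i.
exists (\sum_i L i) => [|i x y x1 y1]; first by rewrite sumr_ge0.
have [lt_in | le_ni] := ltnP i n.+1; last first.
  by rewrite !nth_default ?size_char_poly // subrr normr0 mulr_ge0 ?sumr_ge0.
rewrite !G_eval (le_trans (lip (Ordinal lt_in) _ _ x1 y1)) // ler_wpM2r //.
by rewrite (bigD1 (Ordinal lt_in)) //= lerDl sumr_ge0.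
Qed.

End PolyRoots.

(** * Eigenvalue counts along a segment of matrices *)

Lemma char_poly_roots (C : closedFieldType) n (A : 'M[C]_n) :
  exists r, char_poly A = \prod_(z <- r) ('X - z%:P).
Proof.
have [r r_eq] := closed_field_poly_normal (char_poly A).
by exists r; rewrite r_eq (monicP (char_poly_monic A)) scale1r.
Qed.

Lemma size_char_poly_roots (C : fieldType) n (A : 'M[C]_n) r :
  char_poly A = \prod_(z <- r) ('X - z%:P) -> size r = n.
Proof.
move=> /(congr1 (fun p : {poly C} => size p)).
by rewrite size_char_poly size_prod_XsubC => -[].
Qed.

(** The segment is cut into [m] equal steps, so short that the coefficients move by at most the
    tolerance [eta] of [count_roots_stable]; the count is then constant from one grid point to the
    next. *)
Lemma count_roots_homotopy (R : realType) n (M E : 'M[R[i]]_n) (D : pred R[i])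
    (B e : R[i]) (s t : seq R[i]) : 0 <= B -> 0 < e ->
  (forall x z, 0 <= x <= 1 -> root (char_poly (M + x *: E)) z -> `|z| <= B) ->
  (forall x y z w, 0 <= x <= 1 -> 0 <= y <= 1 ->
     root (char_poly (M + x *: E)) z -> root (char_poly (M + y *: E)) w ->
     `|z - w| <= e -> D z = D w) ->
  char_poly M = \prod_(z <- s) ('X - z%:P) ->
  char_poly (M + E) = \prod_(z <- t) ('X - z%:P) ->
  count D s = count D t.
Proof.
move=> B0 e0 bd sepD s_eq t_eq.
have [eta eta0 stable] := count_roots_stable n B0 e0.
have [L L0 lip] := char_poly_pencil_lipschitz M E.
have [m m0 le_m] : exists2 m : nat, (0 < m)%N & L / m%:R <= eta.
  have q0 : 0 <= L / eta by rewrite divr_ge0 // ltW.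
  (* The quotient [L / eta] is a nonnegative real inside [R[i]], so the Archimedean bound is applied
     to its real part; the successor makes [m] positive. *)
  exists (Num.bound (complex.Re (L / eta))).+1 => //.
  rewrite ler_pdivrMr ?ltr0n // mulrC -ler_pdivrMr //.
  rewrite -(RRe_real (ger0_real q0)) -(rmorph_nat (real_complex R)) lecR.
  rewrite (le_trans (ltW (archi_boundP _))) ?ler_nat //.
  by rewrite -ler0c (RRe_real (ger0_real q0)).
have step (x y : R[i]) u v : 0 <= x <= 1 -> 0 <= y <= 1 -> L * `|x - y| <= eta ->
    char_poly (M + x *: E) = \prod_(z <- u) ('X - z%:P) ->
    char_poly (M + y *: E) = \prod_(z <- v) ('X - z%:P) ->
    count D u = count D v.
  move=> x01 y01 close u_eq v_eq.
  have norm1 (a : R[i]) : 0 <= a <= 1 -> `|a| <= 1 by case/andP=> /ger0_norm->.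
  have ru z : z \in u -> root (char_poly (M + x *: E)) z.
    by rewrite u_eq root_prod_XsubC.
  have rv z : z \in v -> root (char_poly (M + y *: E)) z.
    by rewrite v_eq root_prod_XsubC.
  apply: stable => [||z /ru|z /rv|i|z w /ru zu /rv wv].
  - exact: size_char_poly_roots u_eq.
  - exact: size_char_poly_roots v_eq.
  - exact: bd.
  - exact: bd.
  - by rewrite /prod_roots -u_eq -v_eq (le_trans _ close) // lip ?norm1.
  - exact: sepD zu wv.
pose grid k : R[i] := k%:R / m%:R.
have grid01 k : (k <= m)%N -> 0 <= grid k <= 1.
  move=> le_km; rewrite divr_ge0 ?ler0n //= ler_pdivrMr ?ltr0n //.
  by rewrite mul1r ler_nat.
have grid0 : grid 0%N = 0 by rewrite /grid mul0r.
have gridm : grid m = 1 by rewrite /grid divff // pnatr_eq0 -lt0n.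
suff all_k k u : (k <= m)%N ->
    char_poly (M + grid k *: E) = \prod_(z <- u) ('X - z%:P) ->
    count D s = count D u.
  by apply: (all_k m); rewrite // gridm scale1r.
elim: k u => [|k IHk] u le_km u_eq.
  rewrite grid0 in u_eq; apply: (step 0 0 s u) => //; rewrite ?lexx ?ler01 //.
    by rewrite subrr normr0 mulr0 ltW.
  by rewrite scale0r addr0.
have [r r_eq] := char_poly_roots (M + grid k *: E).
rewrite (IHk _ (ltnW le_km) r_eq).
apply: step r_eq u_eq; rewrite ?grid01 ?(ltnW le_km) //.
rewrite -mulrBl -natr1 opprD addrA subrr add0r mulN1r normrN.
by rewrite normfV normr_nat.
Qed.

(** * Euclidean, Frobenius and operator norms *)

Section Norms.
Variable R : realType.
Local Notation C := R[i].
Implicit Types (x y z : C).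

Lemma cabsE z : (cabs z)%:C = `|z|. Proof. by []. Qed.

Lemma cabs_ge0 z : 0 <= cabs z.
Proof. by rewrite -ler0c cabsE normr_ge0. Qed.

Lemma cabsM x y : cabs (x * y) = cabs x * cabs y.
Proof. exact: ComplexField.Normc.normcM. Qed.

Lemma cabsB x y : cabs (x - y) = cabs (y - x).
Proof. by apply: complexI; rewrite !cabsE distrC. Qed.

Lemma cabs_triangle z x y : cabs (x - y) <= cabs (x - z) + cabs (z - y).
Proof. by rewrite -lecR rmorphD /= !cabsE ler_distD. Qed.

Lemma cabs_conj z : cabs z^*%R = cabs z.
Proof. by apply: complexI; rewrite !cabsE norm_conjC. Qed.

(** The squared Frobenius norm, which on a column is the squared Euclidean norm, so that the same
    invariance lemmas serve both. *)
Definition fsq m n (A : 'M[C]_(m, n)) : R :=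
  \sum_(i < m) \sum_(j < n) cabs (A i j) ^+ 2.

Lemma fsq_ge0 m n (A : 'M[C]_(m, n)) : 0 <= fsq A.
Proof. by apply: sumr_ge0 => i _; apply: sumr_ge0 => j _; rewrite sqr_ge0. Qed.

Lemma frobnormE m n (A : 'M[C]_(m, n)) : frobnorm A = Num.sqrt (fsq A).
Proof. by []. Qed.

Lemma enormE n (v : 'cV[C]_n) : enorm v = Num.sqrt (fsq v).
Proof. by congr Num.sqrt; apply: eq_bigr => i _; rewrite big_ord1. Qed.

Lemma enorm_sqr n (v : 'cV[C]_n) : enorm v ^+ 2 = fsq v.
Proof. by rewrite enormE sqr_sqrtr ?fsq_ge0. Qed.

Lemma enorm_ge0 n (v : 'cV[C]_n) : 0 <= enorm v.
Proof. exact: sqrtr_ge0. Qed.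

Lemma enorm_eq0 n (v : 'cV[C]_n) : enorm v = 0 -> v = 0.
Proof.
move=> v0; have /eqP: fsq v = 0 by rewrite -enorm_sqr v0 expr0n.
rewrite psumr_eq0 => [/allP v_eq0|i _]; last by rewrite sumr_ge0 // => j _; rewrite sqr_ge0.
apply/matrixP => i j; rewrite ord1 mxE.
have := v_eq0 i (mem_index_enum _); rewrite big_ord1 sqrf_eq0 => /eqP.
exact: ComplexField.Normc.eq0_normc.
Qed.

Lemma enormZ n a (v : 'cV[C]_n) : enorm (a *: v) = cabs a * enorm v.
Proof.
rewrite /enorm -[cabs a]ger0_norm ?cabs_ge0 // -sqrtr_sqr -sqrtrM ?sqr_ge0 //.
rewrite mulr_sumr; congr Num.sqrt; apply: eq_bigr => i _.
by rewrite mxE cabsM exprMn.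
Qed.

Lemma enorm0 n : enorm (0 : 'cV[C]_n) = 0.
Proof. by rewrite -(scale0r (0 : 'cV_n)) enormZ ComplexField.Normc.normc0 mul0r. Qed.

Lemma fsq_trace m n (A : 'M[C]_(m, n)) : (fsq A)%:C = \tr (A^t* *m A).
Proof.
rewrite /fsq exchange_big rmorph_sum; apply: eq_bigr => j _.
rewrite mxE rmorph_sum; apply: eq_bigr => i _.
by rewrite !mxE rmorphXn /= cabsE normCKC.
Qed.

Lemma fsq_adjoint m n (A : 'M[C]_(m, n)) : fsq (A^t*) = fsq A.
Proof.
rewrite /fsq exchange_big; apply: eq_bigr => i _; apply: eq_bigr => j _.
by rewrite !mxE cabs_conj.
Qed.

Lemma trmxC_mul m n p (A : 'M[C]_(m, n)) (B : 'M[C]_(n, p)) :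
  (A *m B)^t* = B^t* *m A^t*.
Proof. by rewrite trmx_mul map_mxM. Qed.

Lemma fsq_isometry m n p (U : 'M[C]_(p, m)) (A : 'M[C]_(m, n)) :
  U^t* *m U = 1%:M -> fsq (U *m A) = fsq A.
Proof.
move=> UU; apply: complexI; rewrite !fsq_trace trmxC_mul.
by rewrite mulmxA -[_ *m _ *m U]mulmxA UU mulmx1.
Qed.

Lemma fsq_unitary_conj n (U V A : 'M[C]_n) :
  U^t* *m U = 1%:M -> V^t* *m V = 1%:M -> fsq (V^t* *m A *m U) = fsq A.
Proof.
move=> UU VV; rewrite -mulmxA fsq_isometry ?trmxCK ?(mulmx1C VV) //.
by rewrite -fsq_adjoint trmxC_mul fsq_isometry ?fsq_adjoint ?trmxCK ?(mulmx1C UU).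
Qed.

(** A supremum yields usable inequalities only for a bounded set. The row sums of moduli give a
    bound, as every entry of a vector of the unit ball has modulus at most 1. *)
Lemma opnorm_has_ubound m n (A : 'M[C]_(m, n)) : has_ubound
  [set enorm (A *m v) | v in [set v : 'cV[C]_n | enorm v <= 1]]%classic.
Proof.
exists (Num.sqrt (\sum_i (\sum_j cabs (A i j)) ^+ 2)) => _ [v /= v1 <-].
apply: ler_wsqrtr; apply: ler_sum => i _.
rewrite lerXn2r ?nnegrE ?cabs_ge0 ?sumr_ge0 // => [j _|]; first exact: cabs_ge0.
rewrite -lecR cabsE mxE rmorph_sum (le_trans (ler_norm_sum _ _ _)) //.
apply: ler_sum => j _; rewrite normrM -!cabsE -rmorphM lecR.
rewrite -[leRHS]mulr1 ler_wpM2l ?cabs_ge0 // (le_trans _ v1) //.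
rewrite -[leLHS]ger0_norm ?cabs_ge0 // -sqrtr_sqr ler_wsqrtr //.
by rewrite (bigD1 j) //= lerDl sumr_ge0 // => k _; rewrite sqr_ge0.
Qed.

Lemma enorm_mulmx_le m n (A : 'M[C]_(m, n)) v :
  enorm (A *m v) <= opnorm A * enorm v.
Proof.
have [/enorm_eq0 -> | v0] := eqVneq (enorm v) 0.
  by rewrite mulmx0 !enorm0 mulr0.
have v_gt0 : 0 < enorm v by rewrite lt0r v0 enorm_ge0.
have cabsV : cabs ((enorm v)^-1)%:C = (enorm v)^-1.
  by apply: complexI; rewrite cabsE ger0_norm // ler0c invr_ge0 enorm_ge0.
rewrite -ler_pdivrMr // mulrC -cabsV -enormZ scalemxAr.
apply: (ub_le_sup (opnorm_has_ubound A)).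
by exists (((enorm v)^-1)%:C *: v); rewrite //= enormZ cabsV mulVf.
Qed.

Lemma opnorm_ge0 m n (A : 'M[C]_(m, n)) : 0 <= opnorm A.
Proof.
apply: (ub_le_sup (opnorm_has_ubound A)).
by exists 0; rewrite /= ?mulmx0 enorm0 ?ler01.
Qed.

(** The head seeds the fold in [minseq], so inductions keep the head and peel off the second
    element. *)
Lemma minseq_cons2 (a b : R) s : minseq (a :: b :: s) = Num.min b (minseq (a :: s)).
Proof. by rewrite /= big_cons. Qed.

Lemma minseq_le (s : seq R) a : a \in s -> minseq s <= a.
Proof.
case: s => // b s; elim: s a => [|c s IHs] a.
  by rewrite mem_seq1 /= big_nil => /eqP ->.
rewrite minseq_cons2 ge_min !inE orbCA => /orP[/eqP -> | a_in].
  by rewrite lexx.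
by rewrite IHs ?orbT.
Qed.

Lemma minseq_mem (s : seq R) : s != [::] -> minseq s \in s.
Proof.
case: s => // b s _; elim: s => [|c s IHs]; first by rewrite /= big_nil mem_head.
rewrite minseq_cons2 minEle; case: ifP => _; first by rewrite !inE eqxx orbT.
by move: IHs; rewrite !inE => /orP[] ->; rewrite ?orbT.
Qed.

Lemma minseq_image_le (I : finType) (A : {pred I}) (f : I -> R) i :
  i \in A -> minseq [seq f j | j in A] <= f i.
Proof. by move=> Ai; apply: minseq_le; rewrite fintype.image_f. Qed.

(** The element [i] excludes the empty list, on which [minseq] is the default 0. *)
Lemma minseq_image (I : finType) (A : {pred I}) (f : I -> R) i :
  i \in A -> exists2 j, j \in A & minseq [seq f j | j in A] = f j.
Proof.
move=> Ai; apply/fintype.imageP; apply: minseq_mem.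
by apply/eqP=> e; have := fintype.image_f f Ai; rewrite e.
Qed.

Lemma sep_le (P Q : seq C) x y : x \in P -> y \in Q -> sep P Q <= cabs (x - y).
Proof.
by move=> Px Qy; apply: minseq_le; apply/allpairsP; exists (x, y).
Qed.

End Norms.

(** * Eigenvalues under perturbation *)

Section Eigenbasis.
Variables (R : realType) (n : nat).
Local Notation C := R[i].
Implicit Types (M E U : 'M[C]_n) (lam : 'I_n -> C) (u : 'I_n -> 'cV[C]_n).

Definition cols_mx u : 'M[C]_n := \matrix_(i, j) u j i 0.

Lemma col_cols_mx u j : col j (cols_mx u) = u j.
Proof. by apply/matrixP => i k; rewrite !mxE ord1. Qed.

Lemma mulmx_cols_mx u j M : col j (M *m cols_mx u) = M *m u j.
Proof. by rewrite -(col_cols_mx u) !colE mulmxA. Qed.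

Lemma cols_mx_unitary u : orthonormal_basis fullv u ->
  (cols_mx u)^t* *m cols_mx u = 1%:M.
Proof.
move=> [_ onb]; apply/matrixP => i j; rewrite !mxE.
transitivity (((u i)^t* *m u j) 0 0); last by rewrite onb !mxE eqxx mulr1n.
by rewrite mxE; apply: eq_bigr => k _; rewrite !mxE.
Qed.

Lemma cols_mx_eigen M lam u : (forall j, M *m u j = lam j *: u j) ->
  M *m cols_mx u = cols_mx u *m diag_mx (\row_j lam j).
Proof.
move=> eig; apply/matrixP => i j; have /matrixP/(_ i 0) := eig j.
rewrite -mulmx_cols_mx [col _ _ _ _]mxE => ->.
by rewrite mul_mx_diag !mxE mulrC.
Qed.

(** Similarity invariance of the characteristic polynomial: [U] and its adjoint, lifted to constant
    polynomial matrices, diagonalize [char_poly_mx M] without changing the determinant. *)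
Lemma char_poly_eigenbasis M U lam : U^t* *m U = 1%:M ->
  M *m U = U *m diag_mx (\row_j lam j) ->
  char_poly M = \prod_(z <- codom lam) ('X - z%:P).
Proof.
move=> UU MU; have UU' := mulmx1C UU.
have -> : char_poly M = char_poly (diag_mx (\row_j lam j)).
  pose L := map_mx (@polyC C) (U^t*); pose L' := map_mx (@polyC C) U.
  have LL' : L *m L' = 1%:M by rewrite -map_mxM UU map_mx1.
  have -> : diag_mx (\row_j lam j) = U^t* *m M *m U.
    by rewrite -mulmxA MU mulmxA UU mul1mx.
  rewrite /char_poly; have -> : char_poly_mx (U^t* *m M *m U) = L *m char_poly_mx M *m L'.
    rewrite /char_poly_mx mulmxBr mulmxBl !map_mxM.
    by rewrite mul_mx_scalar -scalemxAl LL' scalemx1.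
  by rewrite !det_mulmx mulrAC -det_mulmx LL' det1 mul1r.
rewrite char_poly_trig ?diag_mx_is_trig // big_image.
by apply: eq_bigr => i _; rewrite !mxE eqxx mulr1n.
Qed.

(** Since [eigenvalue] speaks of row vectors, the argument passes to the transpose, which has the
    same characteristic polynomial. *)
Lemma root_char_poly_eigenvector (A : 'M[C]_n) z : root (char_poly A) z ->
  exists2 v : 'cV_n, v != 0 & A *m v = z *: v.
Proof.
have -> : char_poly A = char_poly A^T.
  by rewrite /char_poly -det_tr /char_poly_mx linearB /= tr_scalar_mx map_trmx.
rewrite -eigenvalue_root_char => /eigenvalueP[v Av v0].
exists v^T; last by rewrite -[A]trmxK -trmx_mul Av linearZ.
by apply: contra v0 => /eqP/(congr1 trmx); rewrite trmxK trmx0 => ->.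
Qed.

(** For an eigenvector [v] of [M + E] at [z], the vector [E *m v] has coordinates
    [(z - lam j) * w j 0] in the basis [U], where [w] holds those of [v]. Its norm is thus at least
    the least [cabs (z - lam j)] times that of [v]. Bounding [E] through [c] lets one constant serve
    all [x *: E] with [0 <= x <= 1]. *)
Lemma bauer_fike M E U lam (c : R) z : U^t* *m U = 1%:M ->
  M *m U = U *m diag_mx (\row_j lam j) ->
  (forall v, enorm (E *m v) <= c * enorm v) ->
  root (char_poly (M + E)) z -> exists j, cabs (z - lam j) <= c.
Proof.
move=> UU MU E_le /root_char_poly_eigenvector[v v0 Mv].
have UU' := mulmx1C UU.
have v_gt0 : 0 < enorm v.
  by rewrite lt0r enorm_ge0 andbT; apply: contra v0 => /eqP/enorm_eq0 ->.
have c0 : 0 <= c by rewrite -(pmulr_lge0 _ v_gt0) (le_trans (enorm_ge0 (E *m v))).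
(* A nonzero entry of [v] supplies an index, without which no minimizing [j] could be chosen. *)
have [i _] : exists i, v i 0 != 0.
  apply/existsP; apply: contraNT v0 => /existsPn v0.
  by apply/eqP/matrixP => i k; rewrite ord1 mxE; apply/eqP/negPn/v0.
pose f j := cabs (z - lam j).
have [j _ min_j] := @arg_minP _ _ _ i xpredT f isT.
exists j; rewrite -/(f j).
pose w := U^t* *m v.
have UtE : U^t* *m (E *m v) = \col_j ((z - lam j) * w j 0).
  have -> : E *m v = z *: v - M *m v by rewrite -Mv mulmxDl addrC addKr.
  have -> : M *m v = U *m (diag_mx (\row_j lam j) *m w).
    by rewrite mulmxA -MU /w -mulmxA (mulmxA U) UU' mul1mx.
  rewrite mulmxBr -scalemxAr (mulmxA (U^t*)) UU mul1mx mul_diag_mx.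
  by apply/matrixP => k l; rewrite ord1 !mxE mulrBl.
have norm_w : fsq w = enorm v ^+ 2 by rewrite fsq_isometry ?trmxCK ?enorm_sqr.
have norm_E : fsq (\col_j ((z - lam j) * w j 0)) = enorm (E *m v) ^+ 2.
  by rewrite -UtE fsq_isometry ?trmxCK ?enorm_sqr.
rewrite -(ler_pM2r v_gt0) (le_trans _ (E_le v)) //.
rewrite -ler_sqr ?nnegrE ?mulr_ge0 ?cabs_ge0 ?enorm_ge0 //.
rewrite exprMn -norm_w -norm_E /fsq mulr_sumr; apply: ler_sum => k _.
rewrite !big_ord1 [(\col__ _) _ _]mxE cabsM exprMn ler_wpM2r ?sqr_ge0 //.
by rewrite lerXn2r ?nnegrE ?cabs_ge0 ?min_j.
Qed.

Definition near_cluster lam (J : {set 'I_n}) (c : R) : pred C :=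
  [pred z | [exists j in J, cabs (z - lam j) <= c]].

(* Along the homotopy [M + x E] every eigenvalue stays within [c] of [lam];
   since the two clusters are more than [2 c] apart, none can cross over. *)
Lemma card_near_cluster M E U (Ut : 'M[C]_n) lam (lamt : 'I_n -> C) (J : {set 'I_n}) (c g : R) :
  U^t* *m U = 1%:M -> Ut^t* *m Ut = 1%:M ->
  M *m U = U *m diag_mx (\row_j lam j) ->
  (M + E) *m Ut = Ut *m diag_mx (\row_j lamt j) ->
  (forall v, enorm (E *m v) <= c * enorm v) ->
  0 <= c -> 2 * c < g ->
  {in J & ~: J, forall j k, g <= cabs (lam j - lam k)} ->
  #|[set j | near_cluster lam J c (lamt j)]| = #|J|.
Proof.
move=> UU UUt MU MUt E_le c0 c_lt gap.
have near x z : 0 <= x <= 1 -> root (char_poly (M + x *: E)) z ->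
    exists j, cabs (z - lam j) <= c.
  case/andP=> x0 x1; apply: bauer_fike UU MU _ => v.
  rewrite -scalemxAl enormZ (le_trans _ (E_le v)) // ler_piMl ?enorm_ge0 //.
  by rewrite -lecR cabsE ger0_norm.
have near_lam j : near_cluster lam J c (lam j) = (j \in J).
  apply/exists_inP/idP => [[i iJ near_i] | jJ]; last first.
    by exists j; rewrite // subrr ComplexField.Normc.normc0.
  apply/negPn/negP => jJ; have := gap i j iJ; rewrite inE jJ => /(_ isT).
  rewrite cabsB => /le_trans/(_ near_i); apply/negP; rewrite -ltNge.
  by rewrite (le_lt_trans _ c_lt) // mulrDl mul1r lerDl.
have countE mu : count (near_cluster lam J c) (codom mu) =
    #|[set j | near_cluster lam J c (mu j)]|.
  by rewrite /codom /image_mem count_map cardsE cardE enumT size_filter.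
rewrite -countE.
transitivity (count (near_cluster lam J c) (codom lam)); last first.
  by rewrite countE; apply: eq_card => j; rewrite inE near_lam.
symmetry.
(* Every root lies within [c] of some [lam j], whence [B]. The tolerance is half the margin
   [g - 2 * c]: a crossing from [lam j] through [z] and [w] to [lam k] would have length at most
   [2 * c + (g - 2 * c) / 2], which is less than [g]. *)
pose B := \sum_j cabs (lam j) + `|c|.
apply: (@count_roots_homotopy _ _ M E _ B%:C ((g - 2 * c) / 2)%:C).
- by rewrite ler0c addr_ge0 // sumr_ge0 // => j _; exact: cabs_ge0.
- by rewrite ltcR divr_gt0 ?subr_gt0.
- move=> x z x01 /(near x z x01)[j zj].
  rewrite -cabsE lecR (le_trans _ (_ : cabs (lam j) + cabs (z - lam j) <= _)) //.
    by rewrite -lecR rmorphD /= !cabsE -[z in leLHS](subrK (lam j)) addrC ler_normD.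
  rewrite lerD ?(le_trans zj) ?ler_norm // (bigD1 j) //= lerDl sumr_ge0 // => k _.
  exact: cabs_ge0.
- have cross x y z w : 0 <= x <= 1 -> 0 <= y <= 1 ->
      root (char_poly (M + x *: E)) z -> root (char_poly (M + y *: E)) w ->
      `|z - w| <= ((g - 2 * c) / 2)%:C ->
      near_cluster lam J c z -> near_cluster lam J c w.
    move=> x01 y01 _ /(near _ _ y01)[k wk]; rewrite -cabsE lecR => zw.
    case/exists_inP=> j jJ zj; apply/exists_inP; exists k => //.
    apply/negPn/negP => kJ.
    have := gap j k jJ; rewrite inE kJ => /(_ isT); apply/negP; rewrite -ltNge.
    have := cabs_triangle z (lam j) (lam k); have := cabs_triangle w z (lam k).
    rewrite (cabsB (lam j) z); lra.
  move=> x y z w x01 y01 zr wr zw; apply/idP/idP; first exact: (cross x y).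
  by apply: (cross y x) => //; rewrite distrC.
- exact: char_poly_eigenbasis UU MU.
- exact: char_poly_eigenbasis UUt MUt.
Qed.
End Eigenbasis.

(** * Projectors and overlaps of two orthonormal bases *)

Lemma memv_span_image (F : fieldType) (V : vectType F) (I : finType)
    (A : {pred I}) (b : I -> V) v :
  v \in <<[seq b j | j in A]>>%VS -> exists c : I -> F, v = \sum_(j in A) c j *: b j.
Proof.
rewrite span_def big_image => /memv_sumP[w w_in ->].
have /fin_all_exists[c c_eq] j : exists k, j \in A -> w j = k *: b j.
  case: (boolP (j \in A)) => [jA|_]; last by exists 0.
  by have /vlineP[k ->] := w_in j jA; exists k.
by exists c; apply: eq_bigr => j /c_eq.
Qed.

Section Projectors.
Variables (R : realType) (n : nat).
Local Notation C := R[i].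
Variables (u : 'I_n -> 'cV[C]_n) (onb_u : orthonormal_basis fullv u).
Implicit Types J : {set 'I_n}.

Lemma free_image J : free [seq u j | j in J].
Proof.
have [/basis_free free_u _] := onb_u.
have split_u : perm_eq [seq u j | j : 'I_n]
    ([seq u j | j in J] ++ map u (filter (predC (mem J)) (enum 'I_n))).
  rewrite -map_cat perm_map // perm_sym.
  by rewrite {1}/enum_mem -enumT perm_filterC.
by move: free_u; rewrite (perm_free split_u) => /catl_free.
Qed.

Lemma dim_span_of J : \dim (span_of u J) = #|J|.
Proof. by rewrite /span_of (eqP (free_image J)) size_map -cardE. Qed.

(** The matrix [onb_mx] is an arbitrary choice, orthonormal as soon as one candidate exists; the
    vectors [u j] with [j] in [J], in enumeration order, provide it. *)
Lemma onb_mx_orthonormal_basis J :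
  orthonormal_basis (span_of u J) (fun j => col j (onb_mx (span_of u J))).
Proof.
set V := span_of u J.
have [_ onb] := onb_u.
pose X : 'M[C]_(n, \dim V) :=
  \matrix_(i, j) nth 0 [seq u j | j in J] j i 0.
suff X_onb : orthonormal_basis V (fun j => col j X).
  apply: (@xgetPex _ (0 : 'M_(n, \dim V))
    [set Y | orthonormal_basis V (fun j => col j Y)]%classic).
  by exists X.
have size_s : size [seq u j | j in J] = \dim V by rewrite dim_span_of size_map -cardE.
have colX j : col j X = nth 0 [seq u j | j in J] j.
  by apply/matrixP => i k; rewrite !mxE ord1.
split.
  have -> : [seq col j X | j : 'I_(\dim V)] = [seq u j | j in J].
    apply: (@eq_from_nth _ 0); first by rewrite size_map -cardE card_ord size_s.
    rewrite size_map -cardE card_ord => i lt_i.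
    rewrite (nth_map (Ordinal lt_i)) -?cardE ?card_ord // colX.
    by rewrite nth_enum_ord.
  by rewrite basisEdim subvv size_s leqnn.
move=> i j; rewrite !colX.
have lt_card (k : 'I_(\dim V)) : (k < size (enum J))%N by rewrite -cardE -dim_span_of.
have /card_gt0P[k0 _] : (0 < #|J|)%N by rewrite cardE (leq_trans _ (lt_card i)).
rewrite !(nth_map k0) // onb; congr (_ %:R%:M).
by rewrite nth_uniq ?enum_uniq.
Qed.

(** Whatever basis [X] was chosen, its projector fixes [u j] for [j] in [J], a combination of the
    columns of [X]. It kills the other [u j], because each column of [X] is a combination of vectors
    orthogonal to them. *)
Lemma projector_span_of J : projector (span_of u J) =
  cols_mx u *m diag_mx (\row_j (j \in J)%:R) *m (cols_mx u)^t*.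
Proof.
have UU := cols_mx_unitary onb_u.
have [_ onb] := onb_u.
set P := projector _.
suff PU : P *m cols_mx u = cols_mx u *m diag_mx (\row_j (j \in J)%:R).
  by rewrite -PU -mulmxA (mulmx1C UU) mulmx1.
have [basisX onbX] := onb_mx_orthonormal_basis J.
rewrite /P /projector; set X := onb_mx _ in basisX onbX *.
have XX : X^t* *m X = 1%:M.
  apply/matrixP => i j; have <- : ((col i X)^t* *m col j X) 0 0 = 1%:M i j.
    by rewrite onbX !mxE eqxx mulr1n.
  rewrite !mxE.
  by apply: eq_bigr => k _; rewrite !mxE.
suff Pu j : X *m X^t* *m u j = (j \in J)%:R *: u j.
  apply/matrixP => i j; have /matrixP/(_ i 0) := Pu j.
  rewrite -mulmx_cols_mx [col _ _ _ _]mxE => ->.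
  by rewrite mul_mx_diag !mxE mulrC.
case: (boolP (j \in J)) => jJ.
  have : u j \in <<[seq col j X | j : 'I_(\dim (span_of u J))]>>%VS.
    by rewrite (span_basis basisX) memv_span // map_f ?mem_enum.
  case/memv_span_image => c u_eq.
  have -> : u j = X *m \col_k c k.
    rewrite u_eq; apply/matrixP => i k; rewrite summxE !mxE.
    by apply: eq_bigr => l _; rewrite !mxE mulrC.
  by rewrite -!mulmxA (mulmxA (X^t*)) XX mul1mx scale1r.
rewrite scale0r -mulmxA.
suff -> : X^t* *m u j = 0 by rewrite mulmx0.
apply/matrixP => k l; rewrite ord1 [RHS]mxE.
have : col k X \in span_of u J.
  by apply: (basis_mem basisX); apply/fintype.imageP; exists k.
case/memv_span_image => c col_eq.
transitivity (((col k X)^t* *m u j) 0 0).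
  by rewrite !mxE; apply: eq_bigr => i _; rewrite !mxE.
rewrite col_eq linear_sum map_mx_sum mulmx_suml summxE big1 // => i iJ.
rewrite linearZ /= map_mxZ -scalemxAl onb [i == j](contraNF _ jJ) => [|/eqP <- //].
by rewrite mulr0n !mxE mul0rn mulr0.
Qed.

End Projectors.

(** * The index set [hat_set] and the balance of off-diagonal blocks *)

(** The overall minimum is at most [c]. If [lamt k] is within [c] of some [lam i] with [i] in [J], a
    minimizer outside [J] would put [lam i] within [2 * c < g] of the other cluster. *)
Lemma hat_set_near (R : realType) n (lam lamt : 'I_n -> R[i]) (J : {set 'I_n}) (c g : R) :
  2 * c < g -> {in J & ~: J, forall j k, g <= cabs (lam j - lam k)} ->
  (forall k, exists j, cabs (lamt k - lam j) <= c) -> J != finset.set0 ->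
  hat_set lam lamt J = [set k | near_cluster lam J c (lamt k)].
Proof.
move=> c_lt gap near /finset.set0Pn[j0 j0J]; apply/setP => k; rewrite !inE.
have [j near_j] := near k.
pose f i := cabs (lamt k - lam i).
have [jm _ min_all] := @minseq_image _ _ predT f j isT.
have [jJ jJ_in min_J] := minseq_image f j0J.
have all_le i : f jm <= f i by rewrite -min_all; apply: minseq_image_le.
have J_le i : i \in J -> f jJ <= f i by rewrite -min_J; apply: minseq_image_le.
rewrite min_all min_J; apply/eqP/exists_inP => [eq_min | [i iJ near_i]].
  by exists jJ; rewrite // -/(f jJ) -eq_min (le_trans (all_le j)).
apply/eqP; rewrite eq_le all_le /= J_le //.
apply/negPn/negP => jmJ; have := gap i jm iJ; rewrite inE jmJ => /(_ isT).
apply/negP; rewrite -ltNge; have := cabs_triangle (lamt k) (lam i) (lam jm).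
have := all_le j; rewrite /f (cabsB (lam i) (lamt k)) => *; lra.
Qed.

(** Adding the block of [K] and [J] completes the left side to full columns over [J], of total
    [#|J|], and the right side to full rows over [K], of total [#|K|]. *)
Lemma doubly_stochastic_offdiag (R : numDomainType) (I : finType) (w : I -> I -> R)
    (J K : {set I}) :
  (forall j, \sum_k w k j = 1) -> (forall k, \sum_j w k j = 1) -> #|J| = #|K| ->
  \sum_(k in ~: K) \sum_(j in J) w k j = \sum_(k in K) \sum_(j in ~: J) w k j.
Proof.
move=> col_sum row_sum cardJK.
pose a := \sum_(k in K) \sum_(j in J) w k j.
apply: (@addrI _ a); transitivity (#|J|%:R : R).
  rewrite /a exchange_big [X in _ + X]exchange_big -big_split /= -sumr_const.
  apply: eq_bigr => j _; rewrite -(col_sum j) (bigID (mem K) predT) /=.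
  by congr (_ + _); apply: eq_bigl => k; rewrite inE.
rewrite cardJK /a -big_split -sumr_const; apply: eq_bigr => k _.
rewrite -(row_sum k) (bigID (mem J) predT) /=.
by congr (_ + _); apply: eq_bigl => j; rewrite inE.
Qed.

Section TwoBases.
Variables (R : realType) (n : nat) (u ut : 'I_n -> 'cV[R[i]]_n).
Hypotheses (onb_u : orthonormal_basis fullv u) (onb_ut : orthonormal_basis fullv ut).

Let U := cols_mx u.
Let Ut := cols_mx ut.
Let UU : U^t* *m U = 1%:M := cols_mx_unitary onb_u.
Let UUt : Ut^t* *m Ut = 1%:M := cols_mx_unitary onb_ut.

(** The squared modulus of the inner product of [ut k] and [u j]. *)
Definition overlap k j : R := cabs ((Ut^t* *m U) k j) ^+ 2.

Lemma overlap_ge0 k j : 0 <= overlap k j.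
Proof. exact: sqr_ge0. Qed.

(** Column [j] holds the coordinates of [A *m u j] in the basis [ut]. Taking [A] to be the identity
    gives the unit column sums of [overlap]; the perturbation gives the numerators of the first
    bound. *)
Lemma sum_col_unitary (A : 'M[R[i]]_n) j :
  \sum_k cabs ((Ut^t* *m A *m U) k j) ^+ 2 = enorm (A *m u j) ^+ 2.
Proof.
rewrite enorm_sqr -(@fsq_isometry _ _ _ _ (Ut^t*)) ?trmxCK ?(mulmx1C UUt) //.
rewrite -mulmx_cols_mx colE !mulmxA -colE /fsq.
by apply: eq_bigr => k _; rewrite big_ord1 [col _ _ _ _]mxE.
Qed.

Lemma sum_overlap_col j : \sum_k overlap k j = 1.
Proof.
have := sum_col_unitary 1%:M j; rewrite mulmx1 mul1mx => ->.
rewrite enorm_sqr; apply: complexI; rewrite fsq_trace.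
by have [_ ->] := onb_u; rewrite eqxx mxtrace1.
Qed.
End TwoBases.

Lemma overlapC (R : realType) n (u ut : 'I_n -> 'cV[R[i]]_n) k j :
  overlap u ut k j = overlap ut u j k.
Proof.
have swap : (cols_mx u)^t* *m cols_mx ut = ((cols_mx ut)^t* *m cols_mx u)^t*.
  by rewrite trmxC_mul trmxCK.
by rewrite /overlap swap !mxE cabs_conj.
Qed.

Lemma sum_overlap_row (R : realType) n (u ut : 'I_n -> 'cV[R[i]]_n) k :
  orthonormal_basis fullv u -> orthonormal_basis fullv ut ->
  \sum_j overlap u ut k j = 1.
Proof.
move=> onb_u onb_ut; rewrite -(sum_overlap_col onb_ut onb_u k).
by apply: eq_bigr => j _; exact: overlapC.
Qed.

(** * The subspace distance and the perturbation in terms of overlaps *)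

Section Distance.
Variables (R : realType) (n : nat) (u ut : 'I_n -> 'cV[R[i]]_n).
Hypotheses (onb_u : orthonormal_basis fullv u) (onb_ut : orthonormal_basis fullv ut).
Implicit Types J K : {set 'I_n}.

(** Seen between the two bases, the difference of projectors has [(k, j)] entry
    [((j \in J)%:R - (k \in K)%:R) * W k j], which survives only when exactly one membership
    holds. *)
Lemma fsq_projectorB J K :
  fsq (projector (span_of u J) - projector (span_of ut K)) =
  \sum_(k in ~: K) \sum_(j in J) overlap u ut k j +
  \sum_(k in K) \sum_(j in ~: J) overlap u ut k j.
Proof.
have UU := cols_mx_unitary onb_u; have UUt := cols_mx_unitary onb_ut.
rewrite -(fsq_unitary_conj _ UU UUt) !projector_span_of //.
set W := (cols_mx ut)^t* *m cols_mx u.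
have -> : forall D1 D2, (cols_mx ut)^t* *m (cols_mx u *m D1 *m (cols_mx u)^t* -
    cols_mx ut *m D2 *m (cols_mx ut)^t*) *m cols_mx u = W *m D1 - D2 *m W.
  move=> D1 D2; rewrite mulmxBr mulmxBl; congr (_ - _).
    by rewrite -!mulmxA UU mulmx1 mulmxA.
  by rewrite !mulmxA UUt mul1mx -mulmxA.
have entry k j : cabs ((W *m diag_mx (\row_j (j \in J)%:R) -
    diag_mx (\row_j (j \in K)%:R) *m W) k j) ^+ 2 =
    ((j \in J) (+) (k \in K))%:R * overlap u ut k j.
  have -> : (W *m diag_mx (\row_j (j \in J)%:R) -
    diag_mx (\row_j (j \in K)%:R) *m W) k j = ((j \in J)%:R - (k \in K)%:R) * W k j.
    by rewrite mul_mx_diag mul_diag_mx !mxE mulrBl [X in X - _]mulrC.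
  rewrite cabsM exprMn; congr (_ * _).
  case: (j \in J) (k \in K) => [] [];
    by rewrite ?subrr ?subr0 ?sub0r /= ?oppr0 ?sqrrN ?expr1n ?expr0n /= ?addr0
               ?sqrtr0 ?sqrtr1 ?expr1n ?expr0n.
rewrite /fsq (bigID (mem K)) [LHS]addrC /=; congr (_ + _).
  apply: eq_big => [k|k /negPf kK]; first by rewrite inE.
  rewrite [RHS]big_mkcond; apply: eq_bigr => j _.
  by rewrite entry kK addbF; case: ifP => _; rewrite ?mul1r ?mul0r.
apply: eq_bigr => k kK; rewrite [RHS]big_mkcond; apply: eq_bigr => j _.
by rewrite entry kK addbT inE; case: ifP => _; rewrite ?mul1r ?mul0r.
Qed.

(** The two off-diagonal blocks have equal sums, and the resulting factor 2 cancels the one in the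
    normalization of [dsp]. *)
Lemma dsp_span_of J K : #|J| = #|K| -> dsp (span_of u J) (span_of ut K) =
  1 / Num.sqrt #|J|%:R * Num.sqrt (\sum_(k in ~: K) \sum_(j in J) overlap u ut k j).
Proof.
move=> cardJK; rewrite /dsp frobnormE fsq_projectorB.
rewrite -(doubly_stochastic_offdiag (sum_overlap_col onb_u onb_ut) _ cardJK); last first.
  by move=> k; exact: sum_overlap_row.
rewrite dim_span_of // natrM sqrtrM // -mulr2n.
set a := \sum_(k in _) _; rewrite -[a *+ 2]mulr_natl sqrtrM // invfM mulrACA.
by rewrite mulVf ?mul1r ?div1r // sqrtr_eq0 -ltNge ltr0n.
Qed.

Variables (M Mt : 'M[R[i]]_n) (lam lamt : 'I_n -> R[i]).
Hypotheses (eig_u : forall j, M *m u j = lam j *: u j)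
           (eig_ut : forall j, Mt *m ut j = lamt j *: ut j).

Lemma perturbation_overlap k j :
  cabs (((cols_mx ut)^t* *m (Mt - M) *m cols_mx u) k j) ^+ 2 =
  cabs (lamt k - lam j) ^+ 2 * overlap u ut k j.
Proof.
have UUt := cols_mx_unitary onb_ut.
rewrite mulmxBr mulmxBl -[_ *m M *m _]mulmxA (cols_mx_eigen eig_u).
have -> : (cols_mx ut)^t* *m Mt = diag_mx (\row_j lamt j) *m (cols_mx ut)^t*.
  rewrite -[LHS]mulmx1 -(mulmx1C UUt) -!mulmxA (mulmxA Mt) (cols_mx_eigen eig_ut).
  by rewrite !mulmxA UUt mul1mx.
rewrite mulmxA -[diag_mx _ *m _ *m _]mulmxA mul_diag_mx mul_mx_diag /overlap -exprMn -cabsM.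
by congr (cabs _ ^+ 2); rewrite !mxE mulrBl [X in _ - X]mulrC.
Qed.

(** For fixed [j], the entries of the perturbation in column [j] dominate [delta j] times those of
    [W] for [k] in [K]; extending the sum to all [k] gives the full squared norm of
    [(Mt - M) *m u j]. *)
Lemma sum_overlap_le (A K : {set 'I_n}) (delta : 'I_n -> R) :
  (forall j, j \in A -> 0 < delta j) ->
  (forall k j, k \in K -> j \in A -> delta j <= cabs (lamt k - lam j)) ->
  \sum_(k in K) \sum_(j in A) overlap u ut k j <=
  \sum_(j in A) (enorm ((Mt - M) *m u j) / delta j) ^+ 2.
Proof.
move=> delta0 le_delta; rewrite exchange_big; apply: ler_sum => j jA.
have d0 := delta0 j jA.
rewrite expr_div_n ler_pdivlMr ?exprn_gt0 // mulr_suml.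
rewrite -(sum_col_unitary _ onb_ut) big_mkcond /=; apply: ler_sum => k _.
case: ifP => kK; last exact: sqr_ge0.
rewrite perturbation_overlap mulrC ler_wpM2r ?overlap_ge0 //.
by rewrite lerXn2r ?nnegrE ?cabs_ge0 ?le_delta ?ltW.
Qed.

End Distance.

(** * Assembly of the bounds on the distance *)

Lemma sqrt_sum_le (R : rcfType) (I : finType) (A : {pred I}) (f : I -> R) (t : R) :
  0 <= t -> (forall j, j \in A -> f j ^+ 2 <= t ^+ 2) ->
  Num.sqrt (\sum_(j in A) f j ^+ 2) <= Num.sqrt #|A|%:R * t.
Proof.
move=> t0 le_t; rewrite -[X in _ * X]ger0_norm // -sqrtr_sqr -sqrtrM ?ler0n //.
by apply: ler_wsqrtr; rewrite mulr_natl -sumr_const; apply: ler_sum.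
Qed.

Theorem proposition2 (R : realType) (n q : nat) (M Mt : 'M[R[i]]_n)
    (lam lamt : 'I_n -> R[i]) (u ut : 'I_n -> 'cV[R[i]]_n) (J : {set 'I_n})
    (normalM : M \is normalmx) (normalMt : Mt \is normalmx)
    (onb_u : orthonormal_basis fullv u) (onb_ut : orthonormal_basis fullv ut)
    (eig_u : forall j, M *m u j = lam j *: u j)
    (eig_ut : forall j, Mt *m ut j = lamt j *: ut j)
    (cardJ : #|J| = q) (q_range : (1 <= q <= n - 1)%N)
    (gap : opnorm (Mt - M) <
      1 / 2 * sep [seq lam j | j in J] [seq lam j | j in ~: J]) :
  let E := Mt - M in
  let sepJ := sep [seq lam j | j in J] [seq lam j | j in ~: J] in
  let d := dsp (span_of u J) (span_of ut (hat_set lam lamt J)) in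
  (d <=
   1 / Num.sqrt q%:R *
     Num.min
       (Num.sqrt (\sum_(j in J)
          (enorm (E *m u j) /
           (minseq [seq cabs (lam k - lam j) | k in ~: J] - opnorm E)) ^+ 2))
       (Num.sqrt (\sum_(j in ~: J)
          (enorm (E *m u j) /
           (minseq [seq cabs (lam k - lam j) | k in J] - opnorm E)) ^+ 2))
   <= Num.min 1 (Num.sqrt ((n - q)%:R / q%:R)) *
        (opnorm E / (sepJ - opnorm E)))
  /\
  d <= (1 / Num.sqrt (2 * q)%:R * frobnorm E) / (sepJ - opnorm E).
Proof.
move=> E sepJ d.
pose eps := opnorm E; rewrite -/eps -/sepJ -/E in gap *.
have eps0 : 0 <= eps by exact: opnorm_ge0.
have {}gap : 2 * eps < sepJ by move: gap; rewrite -/sepJ; lra.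
have Mt_eq : M + E = Mt by rewrite /E addrC subrK.
have UU := cols_mx_unitary onb_u; have UUt := cols_mx_unitary onb_ut.
have MU := cols_mx_eigen eig_u; have MtUt := cols_mx_eigen eig_ut.
have sep_gap : {in J & ~: J, forall j k, sepJ <= cabs (lam j - lam k)}.
  by move=> j k jJ kJ; apply: sep_le; apply: fintype.image_f.
have cardJc : #|~: J| = (n - q)%N by rewrite cardsCs finset.setCK card_ord cardJ.
(* The complement of [J] is nonempty, so the minima over it are genuine and not default values. *)
have n_q : (0 < n - q)%N.
  by case/andP: q_range => q0 qn; rewrite subn_gt0 (leq_ltn_trans qn) // subn1 ltn_predL
    (leq_trans q0) // (leq_trans qn) ?leq_subr.
have /card_gt0P[j0 j0J] : (0 < #|J|)%N by rewrite cardJ; case/andP: q_range.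
have /card_gt0P[k0 k0J] : (0 < #|~: J|)%N by rewrite cardJc.
have near k : exists j, cabs (lamt k - lam j) <= eps.
  apply: (bauer_fike UU MU (@enorm_mulmx_le _ _ _ E)).
  by rewrite Mt_eq (char_poly_eigenbasis UUt MtUt) root_prod_XsubC codom_f.
set K := hat_set lam lamt J in d *.
have K_eq : K = [set k | near_cluster lam J eps (lamt k)]%SET.
  by apply: (hat_set_near gap sep_gap near); apply/finset.set0Pn; exists j0.
have cardJK : #|J| = #|K|.
  rewrite K_eq (@card_near_cluster _ _ M E (cols_mx u) (cols_mx ut) _ _ _ _ sepJ) ?Mt_eq //.
  exact: enorm_mulmx_le.
have q0 : 0 < q%:R :> R by rewrite ltr0n; case/andP: q_range.
have near_K k : k \in K -> exists2 i, i \in J & cabs (lamt k - lam i) <= eps.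
  by rewrite K_eq inE => /exists_inP.
have near_Kc k : k \in ~: K -> exists2 i, i \in ~: J & cabs (lamt k - lam i) <= eps.
  rewrite K_eq !inE => /exists_inP far; have [i near_i] := near k.
  by exists i; rewrite // inE; apply/negP => iJ; apply: far; exists i.
pose offdiag := \sum_(k in ~: K) \sum_(j in J) overlap u ut k j.
have offdiagE : offdiag = \sum_(k in K) \sum_(j in ~: J) overlap u ut k j.
  apply: doubly_stochastic_offdiag => // [j | k]; first exact: sum_overlap_col.
  exact: sum_overlap_row.
have d_eq : d = 1 / Num.sqrt q%:R * Num.sqrt offdiag.
  by rewrite /d (dsp_span_of onb_u onb_ut cardJK) cardJ.
(* Moving from [lam i] to the nearby [lamt k] shortens the distance to [lam j] by at most [eps];
   this produces the denominators. *)
have far_from (A : {set 'I_n}) k i j : i \in A -> cabs (lamt k - lam i) <= eps ->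
    minseq [seq cabs (lam l - lam j) | l in A] - eps <= cabs (lamt k - lam j).
  move=> iA near_i; have := minseq_image_le (fun l => cabs (lam l - lam j)) iA.
  have := cabs_triangle (lamt k) (lam i) (lam j); rewrite (cabsB (lam i) (lamt k)).
  by move=> *; lra.
have min_Jc j : j \in J -> sepJ <= minseq [seq cabs (lam k - lam j) | k in ~: J].
  move=> jJ; have [k kJ ->] := minseq_image (fun k => cabs (lam k - lam j)) k0J.
  by rewrite cabsB sep_gap.
have min_J j : j \in ~: J -> sepJ <= minseq [seq cabs (lam k - lam j) | k in J].
  move=> jJ; have [k kJ ->] := minseq_image (fun k => cabs (lam k - lam j)) j0J.
  exact: sep_gap.
have sep_eps : 0 < sepJ - eps by lra.
pose t := eps / (sepJ - eps).
have t0 : 0 <= t by rewrite divr_ge0 // ltW.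
(* As [u j] is a unit vector, the numerator is at most [eps], while the denominator is at least
   [sepJ - eps]. *)
have ratio_le j (m : R) : sepJ <= m -> (enorm (E *m u j) / (m - eps)) ^+ 2 <= t ^+ 2.
  move=> le_m; have m0 : 0 < m - eps by lra.
  rewrite lerXn2r ?nnegrE ?divr_ge0 ?enorm_ge0 ?(ltW m0) ?(ltW sep_eps) //.
  rewrite ler_pM ?invr_ge0 ?enorm_ge0 ?(ltW m0) //; last first.
    by rewrite lef_pV2 ?posrE // lerB.
  rewrite (le_trans (enorm_mulmx_le _ _)) // -[leRHS]mulr1 ler_wpM2l //.
  have [_ onb] := onb_u; rewrite enormE.
  suff -> : fsq (u j) = 1 by rewrite sqrtr1.
  by apply: complexI; rewrite fsq_trace onb eqxx mxtrace1.
have sqrt_q : 0 < Num.sqrt (q%:R : R) by rewrite sqrtr_gt0.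
split; [apply/andP; split|].
(* The first entry of the minimum bounds the block of [J] and [~: K], the second the block of [~: J]
   and [K]; [offdiagE] equates the two sums. *)
- rewrite d_eq ler_wpM2l ?divr_ge0 ?sqrtr_ge0 // le_min.
  apply/andP; split; apply: ler_wsqrtr.
    apply: (sum_overlap_le onb_ut eig_u eig_ut) => [j /min_Jc | k j /near_Kc[i iJ near_i] _].
      by move=> *; lra.
    exact: far_from near_i.
  rewrite offdiagE.
  apply: (sum_overlap_le onb_ut eig_u eig_ut) => [j /min_J | k j /near_K[i iJ near_i] _].
    by move=> *; lra.
  exact: far_from near_i.
(* The minima are compared entry by entry: the sum over [J] has [q] terms and gives 1, that over
   [~: J] has [n - q] terms and gives the square root of the ratio. *)
- rewrite -/t div1r minr_pMl // mul1r minr_pMr ?invr_ge0 ?(ltW sqrt_q) //.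
  rewrite le_min !ge_min; apply/andP; split.
    apply/orP; left; rewrite mulrC ler_pdivrMr // mulrC -cardJ.
    by apply: sqrt_sum_le => // j /min_Jc; exact: ratio_le.
  apply/orP; right; rewrite mulrC ler_pdivrMr // sqrtrM ?ler0n // sqrtrV ?ler0n //.
  rewrite mulrAC divfK ?gt_eqF // -cardJc.
  by apply: sqrt_sum_le => // j /min_J; exact: ratio_le.
have far_entry k j : (j \in J) != (k \in K) ->
    (sepJ - eps) ^+ 2 * overlap u ut k j <=
    cabs (((cols_mx ut)^t* *m E *m cols_mx u) k j) ^+ 2.
  move=> neq; rewrite (perturbation_overlap onb_ut eig_u eig_ut).
  rewrite ler_wpM2r ?overlap_ge0 // lerXn2r ?nnegrE ?cabs_ge0 ?(ltW sep_eps) //.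
  have [jJ | jJ] := boolP (j \in J).
    have [|i iJ near_i] := near_Kc k.
      by move: neq; rewrite jJ finset.in_setC; case: (k \in K).
    by apply: le_trans (far_from _ _ _ _ iJ near_i); rewrite lerB ?min_Jc.
  have [|i iJ near_i] := near_K k.
    by move: neq; rewrite (negPf jJ); case: (k \in K).
  by apply: le_trans (far_from _ _ _ _ iJ near_i); rewrite lerB ?min_J ?finset.in_setC.
(* Both blocks are kept, since they occupy disjoint entries of the conjugated [E]; counting
   [offdiag] twice produces the 2 in [Num.sqrt (2 * q)%:R]. *)
have le_fsq : (sepJ - eps) ^+ 2 * (offdiag + offdiag) <= fsq E.
  rewrite {2}offdiagE -(fsq_unitary_conj E UU UUt) /fsq [leRHS](bigID (mem K)) [leRHS]addrC /=.
  rewrite mulrDr; apply: lerD; rewrite mulr_sumr.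
    rewrite [leRHS](eq_bigl (mem (~: K))) => [|k]; last exact: esym (finset.in_setC _ _).
    apply: ler_sum => k; rewrite finset.in_setC => /negPf kK.
    rewrite mulr_sumr big_mkcond; apply: ler_sum => j _.
    by case: ifP => jJ; [rewrite far_entry ?jJ ?kK | exact: sqr_ge0].
  apply: ler_sum => k kK; rewrite mulr_sumr big_mkcond; apply: ler_sum => j _.
  by rewrite finset.in_setC; case: ifPn => jJ; [rewrite far_entry ?(negPf jJ) ?kK | exact: sqr_ge0].
rewrite ler_pdivlMr // d_eq natrM sqrtrM ?ler0n // !div1r invfM -mulrA.
rewrite [X in X * frobnorm _]mulrC -mulrA ler_wpM2l ?invr_ge0 ?(ltW sqrt_q) //.
rewrite ler_pdivlMl ?sqrtr_gt0 ?ltr0n // frobnormE.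
rewrite -[X in _ * (_ * X)]ger0_norm ?(ltW sep_eps) // -sqrtr_sqr.
rewrite -!sqrtrM ?ler0n //; last first.
  by do 2![apply: sumr_ge0 => ? _]; exact: overlap_ge0.
by apply: ler_wsqrtr; apply: le_trans le_fsq; rewrite le_eqVlt; apply/orP; left; apply/eqP; ring.
Qed.
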